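(* The numbers $e(\mathcal B_n)$ satisfy the recurrence $e(\mathcal B_0)=1$ and, for $n\ge1$, $$e(\mathcal B_n)=\sum_{i=1}^{\lfloor\frac n2\rfloor}\binom{n-1}{2i-1}(2i-1)!\;e(\mathcal B_{n-2i})+\sum_{i=0}^{\lfloor\frac{n-1}2\rfloor}\binom{n-1}{2i}(2i+1)!\;e(\mathcal B_{n-2i-1}).$$
   Context: Write $\mathbf n=\{1,\dots,n\}$ and let $\mathbf n'$ be a disjoint copy. The Brauer monoid $\mathcal B_n$ is the set of all set partitions $\alpha$ of $\mathbf n\cup\mathbf n'$ into blocks of size exactly $2$ ($\mathcal B_0=\{\emptyset\}$). Product: for $\alpha,\beta\in\mathcal B_n$ take a third copy $\mathbf n''$; relabel each lower vertex $x'$ of $\alpha$ as $x''$ and each upper vertex $x$ of $\beta$ as $x''$, and take the union graph $\Gamma(\alpha,\beta)$ on $\mathbf n\cup\mathbf n'\cup\mathbf n''$ (blocks being viewed as edges); $x,y\in\mathbf n\cup\mathbf n'$ are in the same block of $\alpha\beta$ iff they are joined by a path in $\Gamma(\alpha,\beta)$. $e(\mathcal B_n)$ is the number of $\alpha\in\mathcal B_n$ with $\alpha^2=\alpha$. *)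

(* Defs.v *)
From mathcomp Require Import all_boot.

Set Implicit Arguments.
Unset Strict Implicit.
Unset Printing Implicit Defensive.

(* [inl x] is the upper vertex x of n and [inr x] is the lower vertex x' of n';
   the labels 1, ..., n are shifted to 0, ..., n-1. *)
Definition vertex (n : nat) : finType := ('I_n + 'I_n)%type.

Definition brauer (n : nat) : {set {set {set vertex n}}} :=
  [set a | partition a [set: vertex n] & [forall B in a, #|B| == 2]].

(* Vertices of the product graph: [inl v] is v in the union of n and n',
   [inr x] is the middle vertex x''. *)
Definition gvertex (n : nat) : finType := (vertex n + 'I_n)%type.

(* x |-> x and x' |-> x'' *)
Definition relabel_lower (n : nat) (v : vertex n) : gvertex n :=
  match v with
  | inl x => inl (inl x)
  | inr x => inr x
  end.

(* x |-> x'' and x' |-> x' *)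
Definition relabel_upper (n : nat) (v : vertex n) : gvertex n :=
  match v with
  | inl x => inr x
  | inr x => inl (inr x)
  end.

Definition product_graph (n : nat) (a b : {set {set vertex n}}) :
    rel (gvertex n) :=
  fun u v =>
    [exists B in a, [set u; v] == [set relabel_lower x | x in B]]
    || [exists B in b, [set u; v] == [set relabel_upper x | x in B]].

Definition bmul (n : nat) (a b : {set {set vertex n}}) : {set {set vertex n}} :=
  equivalence_partition
    (fun x y : vertex n => connect (product_graph a b) (inl x) (inl y))
    [set: vertex n].

Definition num_idem (n : nat) : nat :=
  #|[set a in brauer n | bmul a a == a]|.

(* Main.v *)
Require Import Defs.
From mathcomp Require Import all_boot all_fingroup zify.

(** Encode a Brauer diagram as the fixed point free involution [f] of the 2n
    vertices exchanging the two ends of each block, and let [s] be the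
    involution exchanging x and x'.  Following alternately a block and the
    passage from a vertex to its mirror image gives a permutation, v |-> s (f v),
    whose cycles are here called tours; a block is crossed by a tour when it
    joins an upper vertex to a lower one.

    In the graph of the product of [f] with itself, the path that starts with a
    crossing block goes through the middle vertices along a tour, until the next
    crossing block of that tour carries it out of the middle.  Hence the
    diagram is idempotent exactly when every tour has at most one crossing
    ([idempotent_single_crossing]): then that path leaves through the block
    by which it came in, while with two crossings on a tour it would join ends of
    different blocks.

    It remains to count these involutions, which is done one block at a time
    along the tour of a chosen vertex v0.  If f v0 = s v0, the tour closes up
    and disappears together with the pair {v0, s v0}.  If f v0 = w is another
    vertex, walk through w to s w and contract: remove the pair {w, s w}, and
    let v0 take over the partner and the colour (upper or lower) of s w.  This
    is the conjugation of [f] by the transposition of v0 and s w, hence a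
    bijection ([placed_conj]), and it removes w and s w from the tours while
    keeping the other vertices in cyclic order ([contract_plain],
    [contract_crossing]).  After a contraction v0 may have the same colour as
    s v0, and the crossing allowed on its tour may be used up; the number of
    ways to go on depends on these two bits and the number of pairs left, and
    is [completions] ([card_admissible]).

    Unrolling the recursion for [completions], a tour through k pairs in all
    can be laid out along (n-1)(n-2)...(n-k+1) sequences of pairs.  A block
    which is not a crossing makes the tour enter the next pair at the other
    colour, so the number of these blocks is even: the tour has no crossing if
    k is even, and one, in any of k places, if k is odd ([completions_unused]).
    With k = 2i and k = 2i+1 these are the two sums of the recurrence. *)

Set Implicit Arguments.
Unset Strict Implicit.
Unset Printing Implicit Defensive.

(** * Tours of a fixed point free involution *)

Section Tours.

Variable V : finType.

Definition matching (f : {perm V}) : bool :=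
  [forall v, (f v != v) && (f (f v) == v)].

Lemma matchingP (f : {perm V}) :
  reflect ((forall v, f v <> v) /\ involutive f) (matching f).
Proof.
apply: (iffP forallP) => [fP | [fN fK] v].
  by split=> v; have /andP[/eqP fv /eqP ffv] := fP v.
by rewrite fK eqxx andbT; apply/eqP/fN.
Qed.

Variables (s : {perm V}) (s_matching : matching s).

Definition tour (f : {perm V}) (v : V) : V := s (f v).

Definition crossing (col : V -> bool) (f : {perm V}) (v : V) : bool :=
  col v != col (f v).

(** The two ends of a block lie on different tours, reverse to each other
    ([tour_not_partner], [tour_mirror]), so that the vertices [v] of a tour with
    [crossing col f v] stand for different blocks. *)
Definition single_crossing (col : V -> bool) (f : {perm V}) : bool :=
  [forall v, forall w, [&& fconnect (tour f) v w, crossing col f v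
                         & crossing col f w] ==> (v == w)].

Definition crossing_free (col : V -> bool) (f : {perm V}) (v : V) : bool :=
  [forall w, fconnect (tour f) v w ==> ~~ crossing col f w].

Lemma single_crossingP (col : V -> bool) (f : {perm V}) :
  reflect (forall v w, fconnect (tour f) v w ->
             crossing col f v -> crossing col f w -> v = w)
          (single_crossing col f).
Proof.
apply: (iffP forallP) => [h v w vw cv cw | h v].
  by have /forallP/(_ w) := h v; rewrite vw cv cw => /eqP.
by apply/forallP=> w; apply/implyP=> /and3P[vw cv cw]; apply/eqP/h.
Qed.

Lemma crossing_freeP (col : V -> bool) (f : {perm V}) (v : V) :
  reflect (forall w, fconnect (tour f) v w -> ~~ crossing col f w)
          (crossing_free col f v).
Proof.
by apply: (iffP forallP) => h w; [move: (h w) => /implyP | apply/implyP/h].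
Qed.

Let sN v : s v <> v. Proof. by case/matchingP: s_matching. Qed.
Let sK : involutive s. Proof. by case/matchingP: s_matching. Qed.

Lemma tour_inj (f : {perm V}) : injective (tour f).
Proof. by move=> x y /perm_inj/perm_inj. Qed.

Lemma tour_sym (f : {perm V}) x y :
  fconnect (tour f) x y = fconnect (tour f) y x.
Proof. by apply: fconnect_sym; apply: tour_inj. Qed.

Section OneMatching.

Variables (f : {perm V}) (f_matching : matching f).
Let fN v : f v <> v. Proof. by case/matchingP: f_matching. Qed.
Let fK : involutive f. Proof. by case/matchingP: f_matching. Qed.

Lemma tour_partner v : tour f (f v) = s v.
Proof. by rewrite /tour fK. Qed.

Lemma crossing_partner col v : crossing col f (f v) = crossing col f v.
Proof. by rewrite /crossing fK eq_sym. Qed.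

(** [f] conjugates v |-> s (f v) to its inverse, so it reverses tours. *)
Lemma tour_mirror v w :
  fconnect (tour f) v w -> fconnect (tour f) (f v) (f w).
Proof.
move=> /iter_findex <-; elim: (findex _ _ _) => [|k IHk] //=.
rewrite tour_sym (same_fconnect1 (@tour_inj f)) tour_partner.
by rewrite {1}/tour sK tour_sym.
Qed.

(** Blocks and mirror pairs alternate along a closed walk, so [v] and its
    partner are traversed in opposite directions.  Formally, a tour that leads
    from [v] to f v in k+2 steps also leads from its second vertex to the
    partner of that vertex in k steps, and this stops at a fixed point of [f]
    or [s]. *)
Lemma tour_not_partner v : ~~ fconnect (tour f) v (f v).
Proof.
apply/negP=> /iter_findex; move: (findex _ _ _) => k.
elim/ltn_ind: k v => -[|[|k]] IHk v.
- by move=> /= /esym/fN.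
- by move/sN.
rewrite iterSr /= => e; apply: (IHk k _ (tour f v)) => //.
apply: (@tour_inj f); rewrite e tour_partner /tour.
by rewrite sK.
Qed.

End OneMatching.

(** * Contraction of a tour *)

Section Contraction.

Variables (f : {perm V}) (f_matching : matching f).
Variables (v0 w : V) (fv0 : f v0 = w) (w_open : w <> s v0).
Let fN v : f v <> v. Proof. by case/matchingP: f_matching. Qed.
Let fK : involutive f. Proof. by case/matchingP: f_matching. Qed.

(* Conjugation by [t] replaces the blocks {v0, w}, {s w, z} by {v0, z} and
   {s w, w}; the latter is a mirror pair, whose tours are fixed points. *)
Let t := tperm v0 (s w).
Let f' := (f ^ t)%g.
Let z := f (s w).

Let f'E x : f' x = t (f (t x)).
Proof. by rewrite -{1}[x](tpermK v0 (s w)) permJ. Qed.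

Let wv0 : w <> v0. Proof. by rewrite -fv0; apply: fN. Qed.
Let swv0 : s w <> v0. Proof. by move=> e; apply: w_open; rewrite -e sK. Qed.
Let zv0 : z <> v0.
Proof. by rewrite /z => e; apply: (@sN w); rewrite -[RHS]fv0 -e fK. Qed.
Let zsw : z <> s w. Proof. exact: fN. Qed.
Let fw : f w = v0. Proof. by rewrite -fv0 fK. Qed.
Let zw : z <> w.
Proof. by move=> e; apply: swv0; have := fw; rewrite -{1}e /z fK. Qed.

Let tK : involutive t. Proof. exact: tpermK. Qed.

Lemma conj_matching : matching (f ^ tperm v0 (s w)).
Proof.
rewrite -/t -/f'; apply/matchingP; split=> v; rewrite !f'E ?tK ?fK ?tK //.
by move/(canRL tK)/fN.
Qed.

Let tE x : x <> v0 -> x <> s w -> t x = x.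
Proof. by move=> /eqP h1 /eqP h2; rewrite tpermD // eq_sym. Qed.

Let f'v0 : f' v0 = z. Proof. by rewrite f'E tpermL tE. Qed.
Let f'z : f' z = v0. Proof. by rewrite f'E (tE zv0 zsw) /z fK tpermR. Qed.
Let f'w : f' w = s w.
Proof. by rewrite f'E (tE wv0 (not_eq_sym (@sN w))) fw tpermL. Qed.
Let f'sw : f' (s w) = w.
Proof. by rewrite f'E tpermR fv0 (tE wv0 (not_eq_sym (@sN w))). Qed.
Let f'D x : x <> v0 -> x <> w -> x <> z -> x <> s w -> f' x = f x.
Proof.
move=> x0 xw xz xs; rewrite f'E (tE x0 xs) tE // => e.
  by apply: xw; rewrite -fv0 -e fK.
by apply: xz; rewrite /z -e fK.
Qed.

(* The tours of [f] contain v0 -> s w and z -> w; [r] merges each of these steps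
   into its first vertex, and so maps the tours of [f] onto those of [f']. *)
Let r x := if x == w then z else if x == s w then v0 else x.
Let rw : r w = z. Proof. by rewrite /r eqxx. Qed.
Let rsw : r (s w) = v0.
Proof. by rewrite /r eqxx; case: eqP => // /sN. Qed.
Let rD x : x <> w -> x <> s w -> r x = x.
Proof. by rewrite /r; case: eqP => // _; case: eqP. Qed.

Let contract_sub x y : fconnect (tour f') x y -> fconnect (tour f) x y.
Proof.
apply: connect_sub => {}x _ /= /eqP <-; rewrite /tour.
have [->|/eqP x0] := eqVneq x v0.
  rewrite f'v0 (_ : s z = iter 2 (tour f) v0) ?fconnect_iter //=.
  by rewrite /tour fv0.
have [->|/eqP xw] := eqVneq x w; first by rewrite f'w sK.
have [->|/eqP xz] := eqVneq x z.
  rewrite f'z (_ : s v0 = iter 2 (tour f) z) ?fconnect_iter //=.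
  by rewrite /tour /z fK sK fw.
have [->|/eqP xs] := eqVneq x (s w); first by rewrite f'sw.
by rewrite f'D //; apply: fconnect1.
Qed.

Let contract_step x : fconnect (tour f') (r x) (r (tour f x)).
Proof.
have rs u : u <> w -> u <> s w -> r (s u) = s u.
  by move=> h1 h2; rewrite rD // => [/(canRL sK)|/perm_inj].
have [->|/eqP x0] := eqVneq x v0.
  rewrite {2}/tour fv0 rsw rD; [exact: connect0 | exact/not_eq_sym |].
  exact/not_eq_sym.
have [->|/eqP xw] := eqVneq x w.
  rewrite {2}/tour fw rw rs; [|exact/not_eq_sym|exact/not_eq_sym].
  by rewrite -f'z; apply: fconnect1.
have [->|/eqP xz] := eqVneq x z.
  by rewrite {2}/tour /z fK sK rw rD.
have [->|/eqP xs] := eqVneq x (s w).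
  by rewrite {2}/tour -/z rsw rs // -f'v0; apply: fconnect1.
rewrite {2}/tour rs.
- by rewrite (rD xw xs) -f'D //; apply: fconnect1.
- by rewrite -fv0 => /perm_inj.
- by move=> e; apply: xz; rewrite /z -e fK.
Qed.

Let retract_connect x : fconnect (tour f) x (r x).
Proof.
have [->|/eqP xw] := eqVneq x w.
  rewrite rw tour_sym (_ : w = tour f z) ?fconnect1 //.
  by rewrite /tour /z fK sK.
have [->|/eqP xs] := eqVneq x (s w); last by rewrite rD.
by rewrite rsw tour_sym -fv0; apply: fconnect1.
Qed.

Let contract_connect x y :
  fconnect (tour f) x y = fconnect (tour f') (r x) (r y).
Proof.
apply/idP/idP => [/iter_findex <- | /contract_sub h].
  elim: (findex _ _ _) => [|k IHk] /=; first exact: connect0.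
  exact: connect_trans IHk (contract_step _).
apply: connect_trans (retract_connect x) (connect_trans h _).
by rewrite tour_sym.
Qed.

Variable col : V -> bool.
Let col' x := col (t x).

Let crossing' x : crossing col' f' x = crossing col f (t x).
Proof. by rewrite /crossing /col' f'E tpermK. Qed.

Let crossing_r x : x <> v0 -> x <> w -> crossing col' f' (r x) = crossing col f x.
Proof.
move=> x0 xw; rewrite crossing'; have [->|/eqP xs] := eqVneq x (s w).
  by rewrite rsw tpermL.
by rewrite rD // tE.
Qed.

(* Crossings at v0 and w = f v0 are the two ends of the removed block; away from
   them [r] is a bijection onto the vertices kept, and it preserves crossings. *)
Let r_onto x : x <> w -> x <> s w -> exists u, [/\ u <> v0, u <> w & r u = x].
Proof.
move=> xw xs; have [->|/eqP x0] := eqVneq x v0.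
  by exists (s w); split=> //; apply: sN.
by exists x; split=> //; apply: rD.
Qed.

Let r_inj x y : x <> v0 -> x <> w -> y <> v0 -> y <> w -> r x = r y -> x = y.
Proof.
move=> x0 xw y0 yw; have [->|/eqP xs] := eqVneq x (s w);
  have [->|/eqP ys] := eqVneq y (s w) => //.
- by rewrite rsw rD // => e; case: y0.
- by rewrite rsw rD.
- by rewrite !rD.
Qed.

Let removed x y : x = w \/ x = s w -> fconnect (tour f') x y -> x = y.
Proof.
move=> xP /iter_findex <-; elim: (findex _ _ _) => [|k IHk] //=.
rewrite -IHk /tour; case: xP => ->; first by rewrite f'w sK.
by rewrite f'sw.
Qed.

Let conn_v0 y : (fconnect (tour f) v0 y) = fconnect (tour f') v0 (r y).
Proof.
by rewrite contract_connect (rD (not_eq_sym wv0)) //; apply/not_eq_sym.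
Qed.

Let free_kept y : crossing_free col' f' v0 -> y <> v0 -> y <> w ->
  fconnect (tour f) v0 y -> ~~ crossing col f y.
Proof.
move=> /crossing_freeP h y0 yw; rewrite conn_v0 => /h.
by rewrite crossing_r.
Qed.

Let free_made : (forall y, y <> v0 -> y <> w -> fconnect (tour f) v0 y ->
    ~~ crossing col f y) -> crossing_free col' f' v0.
Proof.
move=> h; apply/crossing_freeP=> y v0y.
have yw : y <> w.
  move=> e; move: v0y; rewrite e tour_sym => /removed; move/(_ (or_introl erefl)).
  exact: wv0.
have ys : y <> s w.
  move=> e; move: v0y; rewrite e tour_sym => /removed; move/(_ (or_intror erefl)).
  exact: swv0.
have [u [u0 uw e]] := r_onto yw ys.
by rewrite -e crossing_r // h // conn_v0 e.
Qed.

Let single_kept x y : single_crossing col' f' ->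
  x <> v0 -> x <> w -> y <> v0 -> y <> w ->
  fconnect (tour f) x y -> crossing col f x -> crossing col f y -> x = y.
Proof.
move=> /single_crossingP h x0 xw y0 yw xy cx cy.
apply: r_inj => //; apply: h; rewrite ?crossing_r //.
by rewrite -contract_connect.
Qed.

Let single_made : (forall x y, x <> v0 -> x <> w -> y <> v0 -> y <> w ->
    fconnect (tour f) x y -> crossing col f x -> crossing col f y -> x = y) ->
  single_crossing col' f'.
Proof.
move=> h; apply/single_crossingP=> x y xy cx cy.
have [e|/eqP xw] := eqVneq x w; first by apply: removed xy; left.
have [e|/eqP xs] := eqVneq x (s w); first by apply: removed xy; right.
move: (xy); rewrite tour_sym => yx.
have [e|/eqP yw] := eqVneq y w; first by apply/esym/(removed (or_introl e)).
have [e|/eqP ys] := eqVneq y (s w); first by apply/esym/(removed (or_intror e)).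
have [u [u0 uw e]] := r_onto xw xs; have [u' [u0' uw' e']] := r_onto yw ys.
move: cx cy xy; rewrite -e -e' !crossing_r // -contract_connect => cx cy xy.
by congr r; apply: h.
Qed.

(** If the removed block is not a crossing, the crossings of [f] and of its
    contraction correspond to each other under the retraction. *)
Lemma contract_plain : col v0 = col w ->
  single_crossing col f = single_crossing col' f' /\
  crossing_free col f v0 = crossing_free col' f' v0.
Proof.
move=> e.
have c0 : crossing col f v0 = false by rewrite /crossing fv0 e eqxx.
have cw : crossing col f w = false by rewrite -fv0 crossing_partner.
have n0 x : crossing col f x -> x <> v0 /\ x <> w.
  by move=> h; split=> ex; rewrite ex ?c0 ?cw in h.
split; apply/idP/idP.
- by move/single_crossingP=> h; apply: single_made => x y _ _ _ _; apply: h.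
- move=> h; apply/single_crossingP=> x y xy cx cy.
  by have [x0 xw] := n0 _ cx; have [y0 yw] := n0 _ cy; apply: single_kept.
- by move/crossing_freeP=> h; apply: free_made => y _ _; apply: h.
- move=> h; apply/crossing_freeP=> y v0y; apply/negP=> cy.
  by have [y0 yw] := n0 _ cy; have /negP := free_kept h y0 yw v0y.
Qed.

(** If the removed block is a crossing, it is the one allowed on the tour of
    [v0], so nothing else on that tour may be a crossing.  The other end [w] of
    the block lies on the reverse tour, which [tour_mirror] reduces to the
    first one. *)
Lemma contract_crossing : col v0 <> col w ->
  single_crossing col f = single_crossing col' f' && crossing_free col' f' v0.
Proof.
move=> /eqP e.
have c0 : crossing col f v0 by rewrite /crossing fv0.
apply/idP/andP => [/single_crossingP h | [h1 h2]].
  split; first by apply: single_made => x y _ _ _ _; apply: h.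
  apply: free_made => y y0 yw v0y; apply/negP=> cy.
  by apply: y0; rewrite (h v0 y).
have far x : x <> v0 -> fconnect (tour f) v0 x -> ~~ crossing col f x.
  move=> x0 v0x; apply: (free_kept h2) => // xw.
  by move: v0x; rewrite xw -fv0; apply/negP/tour_not_partner.
have far_w x : x <> w -> fconnect (tour f) w x -> ~~ crossing col f x.
  move=> xw wx; rewrite -crossing_partner //; apply: far.
    by move=> e0; apply: xw; rewrite -fv0 -e0 fK.
  by rewrite -fw; apply: tour_mirror.
apply/single_crossingP=> x y xy cx cy.
have [e0|/eqP x0] := eqVneq x v0.
  apply/eqP; rewrite eq_sym; apply: contraTT cy => /eqP yx.
  by apply: far; rewrite -?e0.
have [ew|/eqP xw] := eqVneq x w.
  apply/eqP; rewrite eq_sym; apply: contraTT cy => /eqP yx.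
  by apply: far_w; rewrite -?ew.
move: (xy); rewrite tour_sym => yx.
have [e0|/eqP y0] := eqVneq y v0.
  by have := far x x0; rewrite -e0 yx cx => /(_ isT).
have [ew|/eqP yw] := eqVneq y w.
  by have := far_w x xw; rewrite -ew yx cx => /(_ isT).
exact: single_kept.
Qed.

End Contraction.

(** * Counting involutions with at most one crossing on each tour *)

(** Restricting the set of vertices to a subset [S] is encoded by making [f]
    agree with [s] off [S]: the tours there are then fixed points and put no
    constraint on [f], so all the counts concern one and the same type. *)
Definition placed (S : {set V}) : {set {perm V}} :=
  [set f | matching f & [forall v, (v \notin S) ==> (f v == s v)]].

Lemma placedP (S : {set V}) (f : {perm V}) :
  reflect (matching f /\ forall v, v \notin S -> f v = s v) (f \in placed S).
Proof.
rewrite inE; apply: (iffP andP) => -[fM fS]; split=> //.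
  by move=> v vS; apply/eqP; move: (forallP fS v); rewrite vS.
by apply/forallP=> v; apply/implyP=> vS; apply/eqP/fS.
Qed.

Definition balanced (S : {set V}) (col : V -> bool) : {set {perm V}} :=
  [set f in placed S | single_crossing col f].

(** The flag [t] tells that the crossing allowed on the tour of [v0] was
    removed by an earlier contraction. *)
Definition admissible S col v0 (t : bool) : {set {perm V}} :=
  [set f in placed S | single_crossing col f && (t ==> crossing_free col f v0)].

Lemma admissible_unused S col v0 : admissible S col v0 false = balanced S col.
Proof. by apply/setP=> f; rewrite !in_set andbT. Qed.

Lemma in_admissible S col v0 t f : (f \in admissible S col v0 t)
  = (f \in placed S) && (single_crossing col f && (t ==> crossing_free col f v0)).
Proof. exact: in_set. Qed.

Definition mirror_closed (S : {set V}) := forall v, (s v \in S) = (v \in S).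

Lemma mirror_closedD S w : mirror_closed S -> mirror_closed (S :\: [set w; s w]).
Proof.
move=> SC v; rewrite !inE SC (can2_eq sK sK) (inj_eq perm_inj).
by rewrite [(v == s w) || _]orbC.
Qed.

Lemma card_mirrorD S w m : mirror_closed S -> w \in S -> #|S| = m.+1.*2 ->
  #|S :\: [set w; s w]| = m.*2.
Proof.
move=> SC wS cS; have sub : [set w; s w] \subset S.
  by apply/subsetP=> x /set2P[] ->; rewrite ?SC.
rewrite cardsD (setIidPr sub) cS cards2.
have -> : w != s w by apply/eqP=> /esym/sN.
by rewrite doubleS /= subn2.
Qed.

(** [s] exchanges the two colours. *)
Lemma card_color (S : {set V}) (col : V -> bool) m b :
  mirror_closed S -> {in S, forall v, col (s v) = ~~ col v} -> #|S| = m.*2 ->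
  #|[set v in S | col v == b]| = m.
Proof.
move=> SC colS cS.
have e : #|[set v in S | col v == ~~ b]| = #|[set v in S | col v == b]|.
  rewrite -(card_imset (mem [set v in S | col v == b]) (@perm_inj _ s)).
  apply: eq_card => v; rewrite -{2}[v]sK (mem_imset _ _ (@perm_inj _ s)) !inE SC.
  by case vS: (v \in S) => //=; rewrite colS //; case: (col v) (b) => [] [].
apply: double_inj; rewrite -cS -addnn -{2}e.
rewrite -(cardsID [set v | col v == b] S) -!setIdE; congr (_ + _).
by apply: eq_card => v; rewrite !inE andbC; case: (col v) (b) => [] [].
Qed.

(** Contraction loses no information once [w] is known: {s w, w} is a block
    of the contraction, and conjugating back turns it into {v0, w}. *)
Lemma placed_conj S v0 w f : mirror_closed S -> v0 \in S -> w \in S ->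
    w <> v0 -> w <> s v0 ->
  (f \in placed S) && (f v0 == w)
    = ((f ^ tperm v0 (s w))%g \in placed (S :\: [set w; s w])).
Proof.
move=> SC v0S wS wv0 wsv0.
set t := tperm v0 (s w).
have tK : involutive t by apply: tpermK.
have swv0 : s w <> v0 by move=> e; apply: wsv0; rewrite -e sK.
have tE x : x != v0 -> x != s w -> t x = x.
  by move=> h1 h2; rewrite tpermD // eq_sym.
have tw : t w = w by rewrite tE //; apply/eqP => // /esym/sN.
have fE x : (f ^ t)%g x = t (f (t x)) by rewrite -{1}[x]tK permJ.
apply/andP/placedP => [[/placedP[fM fS] /eqP fv0] | [fM' fS']].
  split=> [|v]; first by apply: conj_matching.
  have /matchingP[fN fK] := fM.
  have fw : f w = v0 by rewrite -fv0 fK.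
  rewrite !inE negb_and negbK fE => /orP[/orP[]/eqP-> | vS].
  - by rewrite tw fw /t tpermL.
  - by rewrite /t tpermR fv0 tw sK.
  have tv : t v = v.
    by rewrite tE //; apply: contraNneq vS => ->; rewrite ?SC.
  rewrite tv fS // tE //; first by apply: contraNneq vS => e; rewrite -SC e.
  by apply: contraNneq vS => /perm_inj ->.
have fE' x : f x = t ((f ^ t)%g (t x)) by rewrite fE !tK.
have fM : matching f.
  have /matchingP[fN' fK'] := fM'; apply/matchingP; split=> v; rewrite fE'.
    by move/(canRL tK)/fN'.
  by rewrite [in f _]fE' tK fK' tK.
have fv0 : f v0 = w by rewrite fE' /t tpermL fS' ?sK // !inE eqxx orbT.
split; last exact/eqP; apply/placedP; split=> // v vS.
have tv : t v = v.
  by rewrite tE //; apply: contraNneq vS => ->; rewrite ?SC.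
rewrite fE' tv fS' ?inE ?(negPf vS) ?andbF // tE //.
  by apply: contraNneq vS => e; rewrite -SC e.
by apply: contraNneq vS => /perm_inj ->.
Qed.

Lemma card_admissible_step S col v0 t w : mirror_closed S -> v0 \in S ->
    w \in S -> w <> v0 -> w <> s v0 ->
  #|[set f in admissible S col v0 t | f v0 == w]|
    = if t && (col v0 != col w) then 0 else
      #|admissible (S :\: [set w; s w]) (fun v => col (tperm v0 (s w) v)) v0
          (t || (col v0 != col w))|.
Proof.
move=> SC v0S wS wv0 wsv0; case: ifPn => [/andP[-> cw] | tc].
  apply/eqP; rewrite cards_eq0; apply/eqP/setP=> f; rewrite !inE /=.
  apply/negbTE/negP=> /andP[/andP[_ /andP[_ /crossing_freeP h]] /eqP fv0].
  by have /negP := h v0 (connect0 _ _); rewrite /crossing fv0.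
set tau := tperm v0 (s w).
have JK (g : {perm V}) : ((g ^ tau) ^ tau = g)%g.
  by rewrite -conjgM tperm2 conjg1.
rewrite -(card_imset _ (@conjg_inj _ tau)); apply: eq_card => g.
rewrite -{1}[g]JK (mem_imset _ _ (@conjg_inj _ tau)) -{2}[g]JK.
move: (g ^ tau)%g => {g} f.
rewrite in_admissible -placed_conj // inE in_admissible inE -!andbA.
case fM: (matching f) => //=; case: (boolP [forall _, _]) => //= _.
rewrite [LHS]andbA andbC; case: eqP => //= fv0.
move: tc; case: (eqVneq (col v0) (col w)) => /= [e|/eqP e]; rewrite ?orbF.
  by have [-> ->] := contract_plain fM fv0 wsv0 e.
by case: t => //= _; rewrite (contract_crossing fM fv0 wsv0 e) andbT.
Qed.

(** When the tour of [v0] closes up, its only possible crossing is the closing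
    step itself. *)
Lemma admissible_close S col v0 t : mirror_closed S -> v0 \in S ->
  [set f in admissible S col v0 t | f v0 == s v0]
    = if t && (col v0 != col (s v0)) then set0
      else balanced (S :\: [set v0; s v0]) col.
Proof.
move=> SC v0S; apply/setP=> f.
have pl : (f \in placed S) && (f v0 == s v0)
    = (f \in placed (S :\: [set v0; s v0])).
  apply/andP/placedP => [[/placedP[fM fS] /eqP fv0] | [fM fS]].
    have /matchingP[fN fK] := fM.
    split=> // v; rewrite !inE negb_and negbK => /orP[/orP[]/eqP-> //| /fS//].
    by rewrite -[in f _]fv0 fK sK.
  split; last by apply/eqP/fS; rewrite !inE eqxx.
  by apply/placedP; split=> // v vS; apply: fS; rewrite inE (negPf vS) andbF.
rewrite inE in_admissible andbAC pl.
have -> : (f \in (if t && (col v0 != col (s v0)) then set0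
      else balanced (S :\: [set v0; s v0]) col))
   = (f \in placed (S :\: [set v0; s v0])) && (single_crossing col f &&
     ~~ (t && (col v0 != col (s v0)))).
  by case: ifP => _; rewrite in_set ?andbT ?andbF // inE.
rewrite -pl; case: placedP => //= -[fM _]; case: eqP => //= fv0.
congr (_ && _); case: t => //=.
rewrite negbK; apply/crossing_freeP/eqP => [h | e v /iter_findex <-].
  by have := h v0 (connect0 _ _); rewrite /crossing fv0 negbK => /eqP.
have -> k : iter k (tour f) v0 = v0.
  by elim: k => //= k ->; rewrite /tour fv0 sK.
by rewrite /crossing fv0 e eqxx.
Qed.

(** With [m] pairs of vertices left, the current one included, [c] tells whether closing the current tour
    is a crossing and [t] whether the tour already has one.  Once it is closed,
    a new tour starts from a vertex coloured differently from its mirror image,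
    with no crossing: this is the state [true false].  Otherwise the tour goes
    on to one of the other m-1 pairs, by a block which is not a crossing, so
    that [c] changes, or by the first one which is. *)
Fixpoint completions (m : nat) (c t : bool) : nat :=
  if m is m'.+1 then
    (if c && t then 0 else completions m' true false)
    + m' * (completions m' (~~ c) t + (if t then 0 else completions m' c true))
  else 1.

Definition admissible_count m := forall S col v0 t,
  mirror_closed S -> #|S| = m.*2 -> v0 \in S ->
  {in S :\: [set v0; s v0], forall v, col (s v) = ~~ col v} ->
  #|admissible S col v0 t| = completions m (col v0 != col (s v0)) t.

(** If no tour has been begun, one can be begun anywhere. *)
Lemma card_balanced_of m : admissible_count m -> forall S col,
  mirror_closed S -> #|S| = m.*2 ->
  {in S, forall v, col (s v) = ~~ col v} ->
  #|balanced S col| = completions m true false.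
Proof.
move=> IHm S col SC cS colS; have [S0|[v vS]] := set_0Vmem S; last first.
  rewrite -(admissible_unused S col v) IHm //.
    by rewrite colS //; case: (col v).
  by move=> u /setDP[uS _]; apply: colS.
have -> : m = 0 by apply/double_inj; rewrite -cS S0 cards0.
rewrite /= -(cards1 s); apply: eq_card => f; rewrite !inE.
apply/andP/eqP => [[/andP[_ /forallP h] _] | ->].
  by apply/permP=> v; apply/eqP; move: (h v); rewrite S0 inE.
rewrite s_matching; split; first by apply/forallP=> v; rewrite eqxx implybT.
apply/single_crossingP=> v w /iter_findex <- _ _.
by elim: (findex _ _ _) => //= k <-; rewrite /tour sK.
Qed.

(** The summands are the possible values of f v0: the mirror image of v0 closes
    the tour, and every other vertex is contracted. *)
Lemma card_admissible m : admissible_count m.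
Proof.
elim: m => [|m IHm] S col v0 t SC cS v0S colS.
  by move/eqP: cS v0S; rewrite cards_eq0 => /eqP ->; rewrite inE.
set A := admissible S col v0 t; pose S' := S :\: [set v0; s v0].
have cS' : #|S'| = m.*2 by apply: card_mirrorD.
have SC' : mirror_closed S' by apply: mirror_closedD.
rewrite -sum1_card (partition_big (fun f : {perm V} => f v0) predT) //=.
have F w : \sum_(f in A | f v0 == w) 1 = #|[set f in A | f v0 == w]|.
  by rewrite -sum1_card; apply: eq_bigl => f; rewrite inE.
rewrite (eq_bigr _ (fun w _ => F w)) {F} (bigD1 (s v0)) //=; congr (_ + _).
  rewrite (admissible_close col t SC v0S) andbC; case: ifP => _; rewrite ?cards0 //.
  by rewrite (card_balanced_of IHm).
rewrite (bigID (mem S')) /= addnC big1 => [|w /andP[wsv0]]; last first.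
  rewrite !inE (negPf wsv0) orbF negb_and negbK => wP.
  apply/eqP; rewrite cards_eq0; apply/eqP/setP=> f; rewrite !inE.
  apply/negbTE/negP=> /andP[/andP[/andP[fM /forallP fS] _] /eqP fv0].
  have /matchingP[fN fK] := fM.
  have [/eqP e|wS] := orP wP; first by apply: (fN v0); rewrite fv0 -e.
  move: (fS w); rewrite wS /= -fv0 fK => /eqP e.
  by move: wS; rewrite -fv0 -SC -e v0S.
rewrite add0n (eq_bigl (mem S')) => [|w]; last first.
  by rewrite !inE; case: eqP; rewrite ?orbT ?andbF.
pose X := completions m (~~ (col v0 != col (s v0))) t.
pose Y := if t then 0 else completions m (col v0 != col (s v0)) true.
rewrite (eq_bigr (fun w => if col w == col v0 then X else Y)) => [|w wS'].
  rewrite (bigID (fun w => col w == col v0)) /=.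
  rewrite (eq_bigr (fun=> X)) => [|w /andP[_ ->] //].
  rewrite [in X in _ + X](eq_bigr (fun=> Y)) => [|w /andP[_ /negPf->] //].
  rewrite [in X in _ + X](eq_bigl (fun w => (w \in S') && (col w == ~~ col v0))).
    by rewrite !sum_nat_cond_const !(card_color _ SC' colS cS') -mulnDr.
  by move=> w; case: (col w) (col v0) => [] [].
have /setDP[wS] := wS'; rewrite !inE negb_or => /andP[/eqP wv0 /eqP wsv0].
rewrite card_admissible_step //.
have swv0 : s w <> v0 by move=> e; apply: wsv0; rewrite -e sK.
have IH t' : #|admissible (S :\: [set w; s w]) (fun v => col (tperm v0 (s w) v)) v0
    t'| = completions m (~~ col w != col (s v0)) t'.
  rewrite IHm.
  - rewrite tpermL colS // tpermD //; first by apply/eqP=> /esym/sN.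
    by apply/eqP => /perm_inj.
  - exact: mirror_closedD.
  - exact: card_mirrorD.
  - rewrite !inE v0S andbT negb_or; apply/andP.
    by split; apply/eqP/not_eq_sym.
  - move=> v /setDP[/setDP[h5]].
    rewrite !inE !negb_or => /andP[h3 h4] /andP[h1 h2].
    have tE x : x != v0 -> x != s w -> tperm v0 (s w) x = x.
      by move=> ? ?; rewrite tpermD // eq_sym.
    rewrite (tE v) // (tE (s v)); first by rewrite colS // !inE h5 negb_or h1 h2.
      by rewrite (can2_eq sK sK).
    by rewrite (inj_eq perm_inj).
rewrite !IH /X /Y.
by case: (col v0) (col w) (col (s v0)) (t) => [] [] [] [].
Qed.

Lemma card_balanced S col m : mirror_closed S -> #|S| = m.*2 ->
  {in S, forall v, col (s v) = ~~ col v} ->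
  #|balanced S col| = completions m true false.
Proof. by apply: card_balanced_of; apply: card_admissible. Qed.

End Tours.

(** * The recurrence for the number of completions *)

(** The index [k] is the number of blocks followed before the tour closes.  None
    of them is a crossing, so [c] is changed k times, and the closing step must
    not be a crossing either. *)
Lemma completions_used m c : completions m.+1 c true =
  \sum_(k < m.+1) (c == odd k) * m ^_ k * completions (m - k) true false.
Proof.
elim: m c => [|m IHm] c; first by rewrite big_ord1; case: c.
rewrite -[LHS]/((if c && true then 0 else completions m.+1 true false)
  + m.+1 * (completions m.+1 (~~ c) true + 0)) addn0 IHm.
rewrite [RHS]big_ord_recl; congr (_ + _).
  by rewrite ffactn0 subn0; case: c; rewrite /= ?mul0n ?mul1n.
rewrite big_distrr; apply: eq_bigr => k _.
rewrite lift0 ffactSS subSS /= mulnA mulnCA !mulnA; congr (_ * _ * _ * _).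
by case: c (odd k) => [] [].
Qed.

(** Besides the one pattern with no crossing among the [k] blocks that precede the
    closing step, there are [k] patterns with one crossing, and these require that
    closing the tour after k-1 colour changes is not a crossing. *)
Lemma completions_unused m c : completions m.+1 c false =
  \sum_(k < m.+1) (1 + k * (c != odd k)) * m ^_ k * completions (m - k) true false.
Proof.
elim: m c => [|m IHm] c; first by rewrite big_ord1; case: c.
rewrite -[LHS]/((if c && false then 0 else completions m.+1 true false)
  + m.+1 * (completions m.+1 (~~ c) false + completions m.+1 c true)).
rewrite andbF (IHm (~~ c)) completions_used [RHS]big_ord_recl; congr (_ + _).
  by rewrite ffactn0 subn0 !mul1n.
rewrite -big_split big_distrr; apply: eq_bigr => k _.
rewrite lift0 ffactSS subSS /= -!mulnDl.
have -> : 1 + k * (~~ c != odd k) + (c == odd k) = 1 + k.+1 * (c != ~~ odd k).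
  by case: c (odd k) => [] []; lia.
by rewrite !mulnA [m.+1 * _]mulnC.
Qed.

Lemma sum_by_parity (F : nat -> nat) n :
  \sum_(0 <= k < n.+1) F k =
    \sum_(1 <= i < (n.+1 %/ 2).+1) F (2 * i - 1)
    + \sum_(0 <= i < (n %/ 2).+1) F (2 * i).
Proof.
elim: n => [|n IHn]; first by rewrite !big_nat1 big_geq.
rewrite big_nat_recr //= IHn; have [q [e|e]] : exists q, n = q * 2 \/ n = q * 2 + 1.
- by exists (n %/ 2); lia.
- have -> : n.+1 %/ 2 = q by lia.
  have -> : n.+2 %/ 2 = q.+1 by lia.
  have -> : n %/ 2 = q by lia.
  rewrite [in RHS](big_nat_recr _ _ _ (ltn0Sn q)) /=.
  have -> : 2 * q.+1 - 1 = n.+1 by lia.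
  by rewrite addnAC.
- have -> : n.+1 %/ 2 = q.+1 by lia.
  have -> : n.+2 %/ 2 = q.+1 by lia.
  have -> : n %/ 2 = q by lia.
  rewrite [in RHS](big_nat_recr _ _ _ (leq0n q.+1)) /=.
  have -> : 2 * q.+1 = n.+1 by lia.
  by rewrite addnA.
Qed.

Lemma completions_rec n : 1 <= n ->
    completions n true false =
      \sum_(1 <= i < (n %/ 2).+1)
         'C(n - 1, 2 * i - 1) * (2 * i - 1)`! * completions (n - 2 * i) true false
      + \sum_(0 <= i < ((n - 1) %/ 2).+1)
         'C(n - 1, 2 * i) * (2 * i + 1)`! * completions (n - 2 * i - 1) true false.
Proof.
case: n => // m _; rewrite completions_unused subn1 /=.
rewrite -(big_mkord xpredT (fun k =>
  (1 + k * (true != odd k)) * m ^_ k * completions (m - k) true false)).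
rewrite sum_by_parity.
congr (_ + _).
  apply: eq_big_nat => -[//|i] _.
  have -> : 2 * i.+1 - 1 = (2 * i).+1 by lia.
  have -> : odd (2 * i).+1 by lia.
  rewrite muln0 mul1n bin_ffact.
  by have -> : m.+1 - 2 * i.+1 = m - (2 * i).+1 by lia.
apply: eq_big_nat => i _.
have -> : odd (2 * i) = false by lia.
rewrite muln1 -bin_ffact addn1 factS add1n mulnCA -!mulnA.
by have -> : m.+1 - 2 * i - 1 = m - 2 * i by lia.
Qed.

(** * Brauer diagrams as involutions *)

Section Diagrams.

Variable n : nat.
Local Notation V := (vertex n).

Definition reflect_vertex (v : V) : V :=
  match v with inl x => inr x | inr x => inl x end.

Lemma reflect_vertexK : involutive reflect_vertex. Proof. by case. Qed.

Definition mirror : {perm V} := perm (inv_inj reflect_vertexK).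

Definition upper (v : V) : bool := if v is inl _ then true else false.

Definition position (v : V) : 'I_n := match v with inl x | inr x => x end.

Lemma mirror_matching : matching mirror.
Proof.
apply/matchingP; split=> v; rewrite !permE ?reflect_vertexK //.
by case: v.
Qed.

Lemma upper_mirror v : upper (mirror v) = ~~ upper v.
Proof. by rewrite permE; case: v. Qed.

Lemma position_mirror v : position (mirror v) = position v.
Proof. by rewrite permE; case: v. Qed.

Definition same_edge (f : {perm V}) : rel V := fun u v => (u == v) || (f u == v).

Definition blocks (f : {perm V}) : {set {set V}} :=
  equivalence_partition (same_edge f) [set: V].

Lemma same_edge_equiv (f : {perm V}) : matching f ->
  {in [set: V] & &, equivalence_rel (same_edge f)}.
Proof.
move=> /matchingP[fN fK] u v w _ _ _; rewrite /same_edge eqxx; split=> //.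
by case/orP=> [/eqP -> //|/eqP <-]; rewrite fK orbC.
Qed.

Lemma same_edge_class (f : {perm V}) u :
  [set v in [set: V] | same_edge f u v] = [set u; f u].
Proof. by apply/setP=> v; rewrite !inE /same_edge ![_ == v]eq_sym. Qed.

Lemma eq_equivalence_partition (T : finType) (R R' : rel T) :
  {in [set: T] & &, equivalence_rel R} -> {in [set: T] & &, equivalence_rel R'} ->
  equivalence_partition R [set: T] = equivalence_partition R' [set: T] <-> R =2 R'.
Proof.
move=> eR eR'; split=> [e u v | e].
  rewrite -(pblock_equivalence_partition eR) ?inE // e.
  by rewrite (pblock_equivalence_partition eR') ?inE.
by apply: eq_imset => u; apply/setP=> v; rewrite !inE e.
Qed.

Lemma blocks_inj (f g : {perm V}) :
  matching f -> matching g -> blocks f = blocks g -> f = g.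
Proof.
move=> fM gM; rewrite eq_equivalence_partition; try exact: same_edge_equiv.
move=> e; apply/permP=> u; have /matchingP[fN _] := fM.
have := e u (f u); rewrite /same_edge eqxx orbT.
by move=> /esym/orP[/eqP/esym/fN | /eqP].
Qed.

Lemma blocks_brauer (f : {perm V}) : matching f -> blocks f \in brauer n.
Proof.
move=> fM; rewrite inE equivalence_partitionP; last exact: same_edge_equiv.
have /matchingP[fN _] := fM.
apply/forall_inP=> _ /imsetP[u _ ->]; rewrite same_edge_class cards2.
by have /eqP/negPf := fN u; rewrite eq_sym => ->.
Qed.

Lemma brauer_blocks a : a \in brauer n ->
  exists2 f : {perm V}, matching f & a = blocks f.
Proof.
rewrite inE => /andP[aP /forall_inP a2].
have /and3P[/eqP aC aT _] := aP.
pose mate u := odflt u [pick v | (v != u) && (pblock a u == [set u; v])].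
have mateP u : mate u != u /\ pblock a u = [set u; mate u].
  rewrite /mate; case: pickP => [v /andP[vu /eqP ->] // | none].
  have uC : u \in cover a by rewrite aC inE.
  have /cards2P[x [y [xy e]]] := a2 _ (pblock_mem uC).
  have : u \in [set x; y] by rewrite -e mem_pblock.
  case/set2P=> eu.
    by have := none y; rewrite eq_sym eu xy -eu e -eu eqxx.
  by have := none x; rewrite eu xy -eu e -eu setUC eqxx.
have mateK : involutive mate.
  move=> u; have [mu eu] := mateP u; have [mmu emu] := mateP (mate u).
  have e : pblock a u = pblock a (mate u).
    by apply/esym/same_pblock => //; rewrite eu set22.
  have : mate (mate u) \in [set u; mate u] by rewrite -eu e emu set22.
  by case/set2P=> // e2; rewrite e2 eqxx in mmu.
pose f := perm (inv_inj mateK).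
have fM : matching f.
  apply/matchingP; split=> u; rewrite !permE ?mateK //.
  by apply/eqP; case: (mateP u).
exists f => //; rewrite -[LHS](equivalence_partition_pblock aP).
apply: eq_imset => u; rewrite same_edge_class permE; have [_ <-] := mateP u.
by apply/setP=> v; rewrite !inE.
Qed.

Lemma set2_inj (T : finType) (a b c d : T) : [set a; b] = [set c; d] ->
  (a = c /\ b = d) \/ (a = d /\ b = c).
Proof.
move=> e.
have ha : a \in [set c; d] by rewrite -e set21.
have hb : b \in [set c; d] by rewrite -e set22.
have hc : c \in [set a; b] by rewrite e set21.
have hd : d \in [set a; b] by rewrite e set22.
case/set2P: ha hb hc hd => -> /set2P[] -> /set2P[] ? /set2P[] ?; subst; auto.
Qed.

(** * Idempotent diagrams *)

Section Idempotents.

Variables (f : {perm V}) (f_matching : matching f).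
Let fN v : f v <> v. Proof. by case/matchingP: f_matching. Qed.
Let fK : involutive f. Proof. by case/matchingP: f_matching. Qed.

Let G := product_graph (blocks f) (blocks f).
Local Notation crosses := (crossing upper f).
Local Notation trace := (fconnect (tour mirror f)).

Let graphP g h : reflect
  ((exists v, g = relabel_lower v /\ h = relabel_lower (f v))
   \/ (exists v, g = relabel_upper v /\ h = relabel_upper (f v))) (G g h).
Proof.
apply: (iffP orP) => -[].
- case/exists_inP=> _ /imsetP[v _ ->]; rewrite same_edge_class imsetU1 imset_set1.
  move=> /eqP/set2_inj[] [-> ->]; left; first by exists v.
  by exists (f v); rewrite fK.
- case/exists_inP=> _ /imsetP[v _ ->]; rewrite same_edge_class imsetU1 imset_set1.
  move=> /eqP/set2_inj[] [-> ->]; right; first by exists v.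
  by exists (f v); rewrite fK.
- case=> v [-> ->]; left; apply/exists_inP; exists [set v; f v].
    by rewrite -same_edge_class; apply: imset_f.
  by rewrite imsetU1 imset_set1.
- case=> v [-> ->]; right; apply/exists_inP; exists [set v; f v].
    by rewrite -same_edge_class; apply: imset_f.
  by rewrite imsetU1 imset_set1.
Qed.

Let graph_sym : connect_sym G.
Proof.
apply: sym_connect_sym => g h.
by apply/graphP/graphP; case=> -[v [-> ->]]; [left|right|left|right];
  exists (f v); rewrite fK.
Qed.

Let outer (v : V) : gvertex n := inl v.
Let middle (v : V) : gvertex n := inr (position v).

(* A middle vertex has no side of its own, as it is a lower vertex of the first
   factor and an upper vertex of the second; so each block which is not a
   crossing occurs both outside and in the middle, while a crossing joins each
   of its ends to the middle position of the other. *)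
Let graph_cases g h : G g h -> exists v,
  if crosses v then (g = outer v /\ h = middle (f v))
                    \/ (g = middle v /\ h = outer (f v))
  else (g = outer v /\ h = outer (f v)) \/ (g = middle v /\ h = middle (f v)).
Proof.
case/graphP=> -[v [-> ->]]; exists v; rewrite /crossing /outer /middle;
  by case: v (f v) => x [] y /=; auto.
Qed.

Let graph_edges v : if crosses v then G (outer v) (middle (f v))
   else G (outer v) (outer (f v)) && G (middle v) (middle (f v)).
Proof.
have lo : G (relabel_lower v) (relabel_lower (f v)).
  by apply/graphP; left; exists v.
have up : G (relabel_upper v) (relabel_upper (f v)).
  by apply/graphP; right; exists v.
rewrite /crossing /outer /middle.
by case: v (f v) lo up => x [] y /= lo up; rewrite ?lo ?up.
Qed.

Let middle_tour v : middle (tour mirror f v) = middle (f v).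
Proof. by rewrite /middle position_mirror. Qed.

Let next_crossing u : crosses u -> exists k,
  [/\ crosses (iter k.+1 (tour mirror f) u),
      connect G (outer u) (outer (f (iter k.+1 (tour mirror f) u)))
    & forall j, j < k -> ~~ crosses (iter j.+1 (tour mirror f) u)].
Proof.
move=> cu.
have ex : exists k, crosses (iter k.+1 (tour mirror f) u).
  exists (fingraph.order (tour mirror f) u).-1; rewrite orderSpred iter_order //.
  exact: tour_inj.
have [k ck kmin] := ex_minnP ex; exists k; split=> //; last first.
  by move=> j jk; apply/negP=> /kmin; rewrite leqNgt jk.
have walk j : j <= k -> connect G (outer u) (middle (iter j.+1 (tour mirror f) u)).
  elim: j => [_|j IHj jk].
    by rewrite middle_tour; apply: connect1; have := graph_edges u; rewrite cu.
  apply: connect_trans (IHj (ltnW jk)) _; rewrite [iter _.+2 _ _]iterS middle_tour.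
  apply: connect1; have := graph_edges (iter j.+1 (tour mirror f) u).
  by case: ifP => [/kmin|_ /andP[]//]; rewrite leqNgt jk.
apply: connect_trans (walk k (leqnn k)) _; rewrite graph_sym; apply: connect1.
have := graph_edges (f (iter k.+1 (tour mirror f) u)).
by rewrite crossing_partner // ck fK.
Qed.

(** If some tour through a crossing [u] has another one, the path of the product
    graph that starts at [u] ends at the far end of the next crossing, which is
    not in the block of [u].  Conversely the middle positions on the tour of [u]
    and the two ends of its block are closed under the edges of the graph when
    [u] is the only crossing of its tour. *)
Lemma idempotent_single_crossing :
  (bmul (blocks f) (blocks f) == blocks f) = single_crossing mirror upper f.
Proof.
have eqG : {in [set: V] & &,
    equivalence_rel (fun x y => connect G (outer x) (outer y))}.
  move=> x y z _ _ _; split; first exact: connect0.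
  by move/(same_connect graph_sym).
have eqf := same_edge_equiv f_matching.
transitivity [forall x, forall y, connect G (outer x) (outer y) == same_edge f x y].
  apply/eqP/forallP => [/(eq_equivalence_partition eqG eqf) e x | e].
    by apply/forallP=> y; rewrite e.
  by apply/(eq_equivalence_partition eqG eqf) => x y; apply/eqP/(forallP (e x)).
apply/idP/single_crossingP => [/forallP e u w uw cu cw | single].
  have [k [ck uk kmin]] := next_crossing cu.
  set v := iter _ _ _ in ck uk.
  have uv : trace u v by apply: fconnect_iter.
  have vu : v = u.
    move: uk; rewrite (eqP (forallP (e u) _)) => /orP[/eqP e1 | /eqP/perm_inj //].
    have := tour_not_partner mirror_matching f_matching u.
    by rewrite (_ : f u = v) ?uv // [in f u]e1 fK.
  rewrite -(iter_findex uw); case ej: (findex _ _ _) => [//|j].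
  have jk : ~~ (j < k).
    by apply/negP=> /kmin; rewrite -ej iter_findex // cw.
  have : fingraph.order (tour mirror f) u <= k.+1.
    rewrite leqNgt; apply/negP=> /(findex_iter); rewrite -/v vu findex0.
    by [].
  by move: (findex_max uw); rewrite ej; lia.
apply/forallP=> u; apply/forallP=> v; apply/eqP; apply/idP/idP; last first.
  case/orP=> /eqP <-; first exact: connect0.
  case cu: (crosses u); last first.
    by have := graph_edges u; rewrite cu => /andP[/connect1].
  (* the next crossing on the tour of u can only be u itself *)
  have [k [ck uk _]] := next_crossing cu.
  by rewrite {2}(single u _ (fconnect_iter _ k.+1 u) cu ck).
(* a middle position stands for both vertices there: when one of them is on
   the tour of u, the other one is on the reverse tour *)
pose C (g : gvertex n) := match g with
  | inl v => same_edge f u v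
  | inr x => crosses u && (trace u (inl x) || trace u (inr x)) end.
have Cm x : C (middle x) = crosses u && (trace u x || trace u (f x)).
  rewrite /= (same_fconnect1_r (tour_inj (s:=mirror) (f:=f)) u (f x)).
  rewrite (tour_partner _ f_matching) permE.
  by congr (_ && _); case: x => x //=; rewrite orbC.
have Cedge g h : C g -> G g h -> C h.
  move=> Cg /graph_cases[x]; case: ifP => cx [] [eg eh];
    rewrite {}eg in Cg; rewrite {}eh.
  - rewrite Cm fK; case/orP: Cg => /eqP e.
      by rewrite e cx connect0 orbT.
    by rewrite -e fK connect0 -(crossing_partner f_matching) e cx.
  - rewrite Cm in Cg; case/andP: Cg => cu /orP[] h'.
      by rewrite /= /same_edge (single _ _ h' cu cx) eqxx orbT.
    rewrite -(crossing_partner f_matching) in cx.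
    by rewrite /= /same_edge (single _ _ h' cu cx) eqxx.
  - case/orP: Cg => /eqP <-; first by rewrite /= /same_edge eqxx orbT.
    by rewrite fK /= /same_edge eqxx.
  - by move: Cg; rewrite !Cm fK orbC.
case/connectP=> p Gp ev.
have : C (outer u) by rewrite /= /same_edge eqxx.
rewrite -[same_edge f u v]/(C (outer v)) ev.
by elim: p (outer u) Gp {ev} => //= h p IHp g /andP[gh hp] /Cedge/(_ gh)/IHp; apply.
Qed.

End Idempotents.

Lemma num_idem_completions : num_idem n = completions n true false.
Proof.
transitivity #|[set f | matching f & single_crossing mirror upper f]|.
  rewrite -(card_in_imset (f := blocks)) => [|f g]; last first.
    by rewrite !inE => /andP[fM _] /andP[gM _]; apply: blocks_inj.
  apply: eq_card => a; rewrite inE.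
  apply/andP/imsetP => [[/brauer_blocks[f fM ->]] | [f]].
    by rewrite idempotent_single_crossing // => sf; exists f; rewrite // inE fM.
  rewrite inE => /andP[fM sf] ->; split; first exact: blocks_brauer.
  by rewrite idempotent_single_crossing.
rewrite -(card_balanced mirror_matching (S := [set: V]) (col := upper)).
- by apply: eq_card => f; rewrite [LHS]in_set [RHS]in_set;
  apply/andP/andP => -[h sf]; split=> //;
    [apply/placedP; split=> // v; rewrite inE | case/placedP: h].
- by move=> v; rewrite !inE.
- by rewrite cardsT card_sum card_ord addnn.
- by move=> v _; apply: upper_mirror.
Qed.

End Diagrams.

(** * The recurrence *)

Theorem theorem20 :
  num_idem 0 = 1 /\
  (forall n : nat, 1 <= n ->
    num_idem n =
      \sum_(1 <= i < (n %/ 2).+1)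
         'C(n - 1, 2 * i - 1) * (2 * i - 1)`! * num_idem (n - 2 * i)
      + \sum_(0 <= i < ((n - 1) %/ 2).+1)
         'C(n - 1, 2 * i) * (2 * i + 1)`! * num_idem (n - 2 * i - 1)).
Proof.
split=> [|n n0]; first by rewrite num_idem_completions.
rewrite num_idem_completions completions_rec //.
by congr (_ + _); apply: eq_bigr => i _; rewrite num_idem_completions.
Qed.
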